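(* Let $\Gamma$ be a connected arc-transitive digraph that has Property Z, and let $G=\mathrm{Aut}(\Gamma)$. Let $\varphi:\Gamma\to\vec{\mathbb Z}$ be a surjective digraph homomorphism and $\Gamma_0=\varphi^{-1}(0)$. Suppose that the in-valency and the out-valency of $\Gamma$ are both prime numbers. If the pointwise stabilizer $G_{(\Gamma_0)}$ is non-trivial, then $\Gamma$ is highly-arc-transitive.
   Context: A digraph $\Gamma=(V\Gamma,E\Gamma)$ has vertex set $V\Gamma$ and arc set $E\Gamma\subseteq V\Gamma\times V\Gamma$. It is connected if its underlying undirected graph is connected. For a vertex $v$, $\mathrm{in}(v)=\{u:(u,v)\in E\Gamma\}$ and $\mathrm{out}(v)=\{u:(v,u)\in E\Gamma\}$; their cardinalities are the in-valency and out-valency of $v$. Saying that $\Gamma$ has in-valency $q$ and out-valency $p$ means that every vertex has in-valency $q$ and out-valency $p$ (the two primes in the claim need not be equal). A digraph homomorphism is a map of vertex sets sending arcs to arcs (preserving direction). $\vec{\mathbb Z}$ is the digraph with vertex set $\mathbb Z$ and arcs $(i,i+1)$, $i\in\mathbb Z$. A connected digraph $\Gamma$ has Property Z if there is a surjective digraph homomorphism $\Gamma\to\vec{\mathbb Z}$ (such a homomorphism is unique up to adding an integer constant). A $k$-arc is a sequence of vertices $v_0,\dots,v_k$ with $(v_i,v_{i+1})\in E\Gamma$ for $0\le i<k$ (a 0-arc is a vertex). $\Gamma$ is arc-transitive if $\mathrm{Aut}(\Gamma)$ is transitive on arcs, $k$-arc-transitive if $\mathrm{Aut}(\Gamma)$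 is transitive on $k$-arcs, and highly-arc-transitive if it is $k$-arc-transitive for all $k$. For a set $A$ of vertices, $G_{(A)}=\{g\in G: a^g=a\text{ for all }a\in A\}$. *)

(* Defs.v *)
From HB Require Import structures.
From mathcomp Require Import all_boot all_order all_algebra.
From mathcomp Require Import classical_sets functions cardinality.
From Stdlib Require Import Relation_Operators.
Set Implicit Arguments.
Unset Strict Implicit.
Unset Printing Implicit Defensive.
Local Open Scope classical_set_scope.

Record digraph := Digraph {
  vertex :> Type;
  arc : vertex -> vertex -> Prop }.

Definition in_nbr (Gamma : digraph) (v : Gamma) : set Gamma :=
  [set u | arc u v].

Definition out_nbr (Gamma : digraph) (v : Gamma) : set Gamma :=
  [set u | arc v u].

(* `I_q is {0, ..., q - 1}: every vertex has exactly q in-neighbours. *)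
Definition in_valency (Gamma : digraph) (q : nat) : Prop :=
  forall v : Gamma, (in_nbr v #= `I_q)%card.

Definition out_valency (Gamma : digraph) (p : nat) : Prop :=
  forall v : Gamma, (out_nbr v #= `I_p)%card.

(* Any two vertices are joined by a walk that may traverse arcs in either
   direction. *)
Definition connected (Gamma : digraph) : Prop :=
  forall u v : Gamma, clos_refl_sym_trans Gamma (@arc Gamma) u v.

Definition digraph_hom (Gamma Delta : digraph) (f : Gamma -> Delta) : Prop :=
  forall u v : Gamma, arc u v -> arc (f u) (f v).

Definition vecZ : digraph :=
  @Digraph int (fun i j : int => j = (i + 1)%R).

Definition surjective_hom (Gamma Delta : digraph) (f : Gamma -> Delta) : Prop :=
  digraph_hom f /\ (forall y : Delta, exists x : Gamma, f x = y).

Definition property_Z (Gamma : digraph) : Prop :=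
  exists phi : Gamma -> vecZ, surjective_hom phi.

(* The underlying set of the automorphism group; its identity element is
   idfun. *)
Definition Aut (Gamma : digraph) : set (Gamma -> Gamma) :=
  [set g | bijective g /\ forall u v : Gamma, arc (g u) (g v) <-> arc u v].

Definition pointwise_stabilizer (Gamma : digraph) (A : set Gamma) :
    set (Gamma -> Gamma) :=
  [set g | Aut g /\ forall a, A a -> g a = a].

Definition arc_transitive (Gamma : digraph) : Prop :=
  forall u v u' v' : Gamma, arc u v -> arc u' v' ->
    exists2 g : Gamma -> Gamma, Aut g & g u = u' /\ g v = v'.

Definition is_karc (Gamma : digraph) (k : nat) (s : 'I_k.+1 -> Gamma) : Prop :=
  forall i j : 'I_k.+1, j = i.+1 :> nat -> arc (s i) (s j).

Definition karc_transitive (Gamma : digraph) (k : nat) : Prop :=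
  forall s t : 'I_k.+1 -> Gamma, is_karc s -> is_karc t ->
    exists2 g : Gamma -> Gamma, Aut g & forall i, g (s i) = t i.

Definition highly_arc_transitive (Gamma : digraph) : Prop :=
  forall k : nat, karc_transitive Gamma k.

(* Main.v *)
(** An automorphism preserves the levels of [phi] up to a shift.  If [g] fixes
    level 0 pointwise and moves a vertex, say at a positive level (otherwise
    reverse all arcs), let [m + 1] be the lowest positive level that is moved.
    Replacing [g] by the identity on all levels up to [m] still gives an
    automorphism, since arcs only join consecutive levels.  Hence for every
    vertex [u] the automorphisms fixing all levels up to that of [u] act
    non-trivially on the out-neighbours of [u]; they form a normal subgroup of
    the stabilizer of [u], which is transitive on this set of prime size, so
    they are transitive on it as well.  As they fix every k-arc ending in [u],
    k-arc-transitivity follows by induction on [k]. *)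
Require Import Defs.
From HB Require Import structures.
From mathcomp Require Import all_boot all_order all_algebra.
From mathcomp Require Import boolp classical_sets functions cardinality.
From mathcomp Require Import zify.
From Stdlib Require Import Relation_Operators.
(* Restores [Defs.arc], shadowed by [path.arc]. *)
Import Defs.
Set Implicit Arguments.
Unset Strict Implicit.
Unset Printing Implicit Defensive.
Local Open Scope classical_set_scope.

(** * Equivalence relations on finite sets of prime size *)

(** Each [f] embeds the class of [x] into that of [y], so all classes have the same size. This size
    divides the prime [#|T|] and exceeds 1, hence a single class fills [T]. *)
Lemma homogeneous_equivalence_total (T : finType) (r : rel T) :
  prime #|T| -> equivalence_rel r ->
  (forall x y, exists f : T -> T,
     [/\ injective f, f x = y & forall a b, r a b -> r (f a) (f b)]) ->
  (exists x y, x != y /\ r x y) -> forall x y, r x y.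
Proof.
move=> T_prime r_equiv r_hom [x0 [y0 [neq_xy rxy]]] x y.
have le_class a b : #|r a| <= #|r b|.
  have [f [f_inj <- rf]] := r_hom a b.
  rewrite -(fintype.card_image f_inj (r a)).
  apply/subset_leq_card/fintype.subsetP.
  by move=> _ /fintype.imageP[c rac ->]; apply: rf.
have eq_class a b : #|r a| = #|r b| by apply/eqP; rewrite eqn_leq !le_class.
have refl_r a : r a a by have [] := r_equiv a a a.
have partP : finset.partition (equivalence_partition r finset.setT) finset.setT.
  by apply: equivalence_partitionP => a b c _ _ _; apply: r_equiv.
have unif : {in equivalence_partition r finset.setT,
    forall A : {set T}, #|A| = #|r x|}.
  move=> A /finset.imsetP[a _ ->]; rewrite -(eq_class a).
  by apply: eq_card => b; rewrite finset.inE finset.in_setT.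
have dvd_class : #|r x| %| #|T|.
  by rewrite -cardsT (card_uniform_partition unif partP) dvdn_mull.
have class_gt1 : 1 < #|r x|.
  rewrite (eq_class x x0); apply/card_gt1P; exists x0, y0.
  by split; [exact: refl_r | exact: rxy | ].
have class_neq1 : #|r x| != 1 by rewrite neq_ltn class_gt1 orbT.
have class_card : #|r x| = #|T| by apply/(prime_nt_dvdP T_prime class_neq1).
have /(fintype.subset_cardP class_card)/(_ y) := fintype.subset_predT (r x).
by rewrite !inE.
Qed.

Lemma card_eq_II_enum (T : Type) (A : set T) (n : nat) :
  (A #= `I_n)%card ->
  exists2 e : 'I_n -> T, injective e & forall x, A x <-> exists i, e i = x.
Proof.
move=> /card_esym/card_bijP[f [f' fK f'K]].
have In_mem (i : 'I_n) : (i : nat) \in `I_n by rewrite inE /= ltn_ord.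
exists (fun i : 'I_n => set_val (f (exist _ (i : nat) (In_mem i)))).
  move=> i j /val_inj/(can_inj fK) [] ; exact: val_inj.
move=> x; split => [Ax | [i <-]]; last exact: set_valP.
have Ax' : x \in A by rewrite inE.
pose y := f' (exist _ x Ax').
have lt_y : set_val y < n by have := set_valP y.
exists (Ordinal lt_y).
rewrite (_ : exist _ _ _ = y) ?f'K //; exact: val_inj.
Qed.

Lemma card_eq_II_inhabited (T : Type) (A : set T) (n : nat) :
  0 < n -> (A #= `I_n)%card -> exists x, A x.
Proof.
move=> n_gt0 /card_eq_II_enum[e _ eE].
by exists (e (Ordinal n_gt0)); apply/eE; exists (Ordinal n_gt0).
Qed.

(** * Automorphisms of a digraph *)

Section Automorphisms.
Variable Gamma : digraph.

Lemma Aut_id : @Aut Gamma idfun.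
Proof. by split=> //; exists idfun. Qed.

Lemma Aut_comp (g h : Gamma -> Gamma) : Aut g -> Aut h -> Aut (g \o h).
Proof.
move=> [g_bij gE] [h_bij hE]; split=> [|u v]; first exact: bij_comp.
by rewrite /= gE hE.
Qed.

Lemma Aut_inv (g : Gamma -> Gamma) :
  Aut g -> exists2 g', Aut g' & cancel g g' /\ cancel g' g.
Proof.
move=> [[g' gK g'K] gE]; exists g'; split=> //; first by exists g.
by move=> u v; rewrite -gE !g'K.
Qed.

Lemma vertex_transitive :
  arc_transitive Gamma -> (forall v : Gamma, exists w, arc v w) ->
  forall u v : Gamma, exists2 g, Aut g & g u = v.
Proof.
move=> arc_trans out_ex u v.
have [[u' uu'] [v' vv']] := (out_ex u, out_ex v).
by have [g g_aut [gu _]] := arc_trans _ _ _ _ uu' vv'; exists g.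
Qed.

End Automorphisms.

(** * Levels and the automorphisms fixing all low levels *)

Section Levels.
Import Order.TTheory GRing.Theory Num.Theory.
Local Open Scope ring_scope.
Variables (Gamma : digraph) (phi : Gamma -> int).
Hypothesis Gamma_connected : connected Gamma.
Hypothesis phi_arc : forall u v : Gamma, arc u v -> phi v = phi u + 1.

(** Both [phi u] and [phi (g u)] grow by 1 along an arc, so their difference is constant on a
    connected digraph. *)
Lemma level_shift (g : Gamma -> Gamma) : Aut g ->
  forall u v, phi (g u) - phi u = phi (g v) - phi v.
Proof.
move=> [_ gE] u v; elim: (Gamma_connected u v) => {u v} [u v uv|//|u v _ ->//|].
  have guv : arc (g u) (g v) by apply/gE.
  by rewrite (phi_arc uv) (phi_arc guv); lia.
by move=> u v w _ -> _ ->.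
Qed.

Lemma level_fix (g : Gamma -> Gamma) (a : Gamma) : Aut g -> g a = a ->
  forall u, phi (g u) = phi u.
Proof.
by move=> g_aut ga u; have := level_shift g_aut u a; rewrite ga; lia.
Qed.

Lemma level_karc (k : nat) (s : 'I_k.+1 -> Gamma) : is_karc s ->
  forall i, phi (s i) = phi (s ord0) + (i : nat)%:Z.
Proof.
move=> s_arc [i lt_i]; elim: i lt_i => [|i IH] lt_i.
  by rewrite (_ : Ordinal _ = ord0) ?addr0 //; apply: val_inj.
have lt_i' : (i < k.+1)%N by lia.
have si : arc (s (Ordinal lt_i')) (s (Ordinal lt_i)) by apply: s_arc.
by rewrite (phi_arc si) IH /=; lia.
Qed.

Definition fixes_upto (m : int) (h : Gamma -> Gamma) : Prop :=
  Aut h /\ forall x, phi x <= m -> h x = x.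

Lemma fixes_upto_comp (m : int) (g h : Gamma -> Gamma) :
  fixes_upto m g -> fixes_upto m h -> fixes_upto m (g \o h).
Proof.
move=> [g_aut g_fix] [h_aut h_fix]; split=> [|x le_x]; first exact: Aut_comp.
by rewrite /= h_fix // g_fix.
Qed.

Lemma fixes_upto_inv (m : int) (h h' : Gamma -> Gamma) :
  fixes_upto m h -> Aut h' -> cancel h h' -> fixes_upto m h'.
Proof.
by move=> [_ h_fix] h'_aut hK; split=> // x le_x; rewrite -{1}(h_fix x) ?hK.
Qed.

(** For [g u = u] this is the normality of these automorphisms in the stabilizer of [u]; for general
    [g] it carries them from [u] to [g u]. *)
Lemma fixes_upto_conj (u : Gamma) (g g' h : Gamma -> Gamma) :
  Aut g -> Aut g' -> cancel g' g ->
  fixes_upto (phi u) h -> fixes_upto (phi (g u)) (g \o h \o g').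
Proof.
move=> g_aut g'_aut g'K [h_aut h_fix]; split=> [|x le_x].
  by apply: Aut_comp => //; apply: Aut_comp.
rewrite /= h_fix ?g'K //.
by have := level_shift g_aut u (g' x); rewrite g'K; lia.
Qed.

Lemma truncate_Aut (m : int) (g : Gamma -> Gamma) : Aut g ->
  (forall x, phi (g x) = phi x) -> (forall x, phi x = m -> g x = x) ->
  Aut (fun x => if phi x <= m then x else g x).
Proof.
move=> [[g' gK g'K] gE] g_level g_fix; split.
  exists (fun x => if phi x <= m then x else g' x) => x.
    by case: (ifP (phi x <= m)) => le_x; rewrite ?g_level le_x ?gK.
  have g'_level : phi (g' x) = phi x by rewrite -g_level g'K.
  by case: (ifP (phi x <= m)) => le_x; rewrite ?g'_level le_x ?g'K.
move=> u v; case: ifP => le_u; case: ifP => le_v //.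
(* An arc that crosses the cut starts exactly at level [m], where [g] is the identity. *)
- split=> uv; have gu : g u = u by apply: g_fix; have := phi_arc uv;
    rewrite ?g_level; lia.
    by apply/gE; rewrite gu.
  by rewrite -[u]gu; apply/gE.
(* No arc goes down from above level [m], so both sides are false. *)
- by split=> /phi_arc; rewrite ?g_level; lia.
Qed.

Lemma fixes_upto_nontrivial (g : Gamma -> Gamma) (a x : Gamma) :
  Aut g -> phi a = 0 -> (forall y, phi y = 0 -> g y = y) ->
  0 < phi x -> g x <> x -> (forall v : Gamma, exists u, arc u v) ->
  exists u v h, [/\ arc u v, fixes_upto (phi u) h & h v <> v].
Proof.
move=> g_aut phi_a g_fix0 x_gt0 gx in_ex.
have g_level := level_fix g_aut (g_fix0 _ phi_a).
(* The shift by one makes the least such [n] the level just below the lowest moved positive one. *)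
pose moved n := `[< exists y, phi y = n.+1%:Z /\ g y <> y >].
have ex_moved : exists n, moved n.
  by exists `|phi x - 1|%N; apply/asboolP; exists x; split=> //; lia.
case: (ex_minnP ex_moved) => n /asboolP[v [phi_v gv]] n_min.
have [u uv] := in_ex v; have phi_u : phi u = n%:Z by have := phi_arc uv; lia.
have g_fixn y : phi y = n%:Z -> g y = y.
  (* Level 0 is fixed by hypothesis, a positive level [n] by minimality. *)
  case: n n_min {phi_v phi_u} => [_|n n_min phi_y]; first exact: g_fix0.
  apply: contrapT => gy; have /n_min : moved n by apply/asboolP; exists y.
  by rewrite ltnn.
exists u, v, (fun y => if phi y <= n%:Z then y else g y); split=> //.
  split; first exact: truncate_Aut.
  by move=> y; rewrite phi_u => ->.
by rewrite phi_v lez_nat ltnn.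
Qed.

Lemma fixes_upto_transitive (p : nat) (u0 v0 : Gamma) (h0 : Gamma -> Gamma) :
  arc_transitive Gamma -> prime p -> out_valency Gamma p ->
  arc u0 v0 -> fixes_upto (phi u0) h0 -> h0 v0 <> v0 ->
  forall u v w, arc u v -> arc u w ->
  exists2 h, fixes_upto (phi u) h & h v = w.
Proof.
move=> arc_trans p_prime out_val u0v0 h0_fix h0v0 u v w uv uw.
have [e e_inj eE] := card_eq_II_enum (out_val u).
have arc_e i : arc u (e i) by apply/eE; exists i.
have [/eE[iv <-] /eE[iw <-]] := (uv, uw).
(* The orbit relation on the out-neighbours of [u], read on their indices. *)
pose r i j := `[< exists2 h, fixes_upto (phi u) h & h (e i) = e j >].
have refl_r i : r i i.
  by apply/asboolP; exists idfun => //; split=> //; apply: Aut_id.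
have sym_r i j : r i j -> r j i.
  move=> /asboolP[h h_fix hij]; have [h' h'_aut [hK _]] := Aut_inv h_fix.1.
  apply/asboolP; exists h'; first exact: fixes_upto_inv h_fix h'_aut hK.
  by rewrite -hij hK.
have trans_r i j k : r i j -> r j k -> r i k.
  move=> /asboolP[h h_fix hij] /asboolP[h' h'_fix hjk]; apply/asboolP.
  exists (h' \o h); first exact: fixes_upto_comp.
  by rewrite /= hij hjk.
suff /asboolP : r iv iw by [].
apply: homogeneous_equivalence_total.
- by rewrite card_ord.
- move=> i j k; split=> // rij; apply/idP/idP; last exact: trans_r.
  by apply: trans_r; apply: sym_r.
(* Arc-transitivity gives [g] in the stabilizer of [u] with [g (e i) = e j]; it permutes the
   out-neighbours and, by conjugation, preserves [r]. *)
- move=> i j; have [g g_aut [gu gij]] := arc_trans _ _ _ _ (arc_e i) (arc_e j).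
  have [g' g'_aut [gK g'K]] := Aut_inv g_aut.
  have /choice[f fE] : forall k, exists l, e l = g (e k).
    by move=> k; apply/eE; rewrite /out_nbr /= -{1}gu; apply/g_aut.2.
  exists f; split.
  + by move=> k l fkl; apply/e_inj/(can_inj gK); rewrite -!fE fkl.
  + by apply: e_inj; rewrite fE.
  + move=> k l /asboolP[h h_fix hkl]; apply/asboolP; exists (g \o h \o g').
      by rewrite -{1}gu; apply: fixes_upto_conj.
    by rewrite /= !fE gK hkl.
(* Conjugating [h0] by some [g] with [g u0 = u] relates the two distinct out-neighbours [g v0] and
   [g (h0 v0)] of [u]. *)
- have out_ex x := card_eq_II_inhabited (prime_gt0 p_prime) (out_val x).
  have [g g_aut gu] := vertex_transitive arc_trans out_ex u0 u.
  have [g' g'_aut [gK g'K]] := Aut_inv g_aut.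
  have /eE[i ei] : arc u (g v0) by rewrite -gu; apply/g_aut.2.
  have h0u : h0 u0 = u0 by apply: h0_fix.2.
  have /eE[j ej] : arc u (g (h0 v0)).
    by rewrite -gu; apply/g_aut.2; rewrite -h0u; apply/h0_fix.1.2.
  exists i, j; split.
    apply/eqP => ij; apply: h0v0; apply: (can_inj gK).
    by rewrite -ei -ej ij.
  apply/asboolP; exists (g \o h0 \o g').
    by rewrite -gu; apply: fixes_upto_conj.
  by rewrite /= ei gK ej.
Qed.

Lemma highly_arc_transitive_of_fixes_upto :
  arc_transitive Gamma -> (forall v : Gamma, exists w, arc v w) ->
  (forall u v w, arc u v -> arc u w ->
    exists2 h, fixes_upto (phi u) h & h v = w) ->
  highly_arc_transitive Gamma.
Proof.
move=> arc_trans out_ex fix_trans; elim=> [|k IH] s t s_arc t_arc.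
  have [g g_aut gst] := vertex_transitive arc_trans out_ex (s ord0) (t ord0).
  by exists g => // i; rewrite (ord1 i).
(* Composing with [w] drops the last vertex of an arc sequence. *)
pose w (i : 'I_k.+1) : 'I_k.+2 := widen_ord (leqnSn _) i.
have w_arc (x : 'I_k.+2 -> Gamma) : is_karc x -> is_karc (x \o w).
  by move=> x_arc i j ij; apply: x_arc.
have [g g_aut gst] := IH _ _ (w_arc s s_arc) (w_arc t t_arc).
(* After [g] only the last vertex may be wrong; [h] corrects it. *)
have [h h_fix hgst] : exists2 h,
    fixes_upto (phi (t (w ord_max))) h & h (g (s ord_max)) = t ord_max.
  apply: fix_trans; last by apply: t_arc.
  by rewrite -[t _](gst ord_max); apply/g_aut.2/s_arc.
exists (h \o g); first exact: Aut_comp h_fix.1 g_aut.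
move=> i /=; case: (unliftP ord_max i) => [j ->|->//].
have -> : lift ord_max j = w j by apply/val_inj/lift_max.
(* The earlier vertices of [t] lie at or below the level of [t (w ord_max)], so [h] leaves them in
   place. *)
rewrite (gst j) /= h_fix.2 // (level_karc t_arc (w j)).
by rewrite (level_karc t_arc (w ord_max)) lerD2l lez_nat /= -ltnS ltn_ord.
Qed.

Lemma highly_arc_transitive_of_moved_above (p : nat) (g : Gamma -> Gamma)
    (a x : Gamma) :
  arc_transitive Gamma -> prime p -> out_valency Gamma p ->
  (forall v : Gamma, exists u, arc u v) ->
  Aut g -> phi a = 0 -> (forall y, phi y = 0 -> g y = y) ->
  0 < phi x -> g x <> x ->
  highly_arc_transitive Gamma.
Proof.
move=> arc_trans p_prime out_val in_ex g_aut phi_a g_fix x_gt0 gx.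
have [u [v [h [uv h_fix hv]]]] :=
  fixes_upto_nontrivial g_aut phi_a g_fix x_gt0 gx in_ex.
apply: highly_arc_transitive_of_fixes_upto => //.
  by move=> y; apply: card_eq_II_inhabited (prime_gt0 p_prime) (out_val y).
exact: fixes_upto_transitive arc_trans p_prime out_val uv h_fix hv.
Qed.

End Levels.

(** * Reversal of arcs *)

Definition converse (Gamma : digraph) : digraph :=
  @Digraph Gamma (fun u v => arc v u).

Lemma connected_converse (Gamma : digraph) :
  connected Gamma -> connected (converse Gamma).
Proof.
move=> conn u v; elim: (conn u v) => {u v} [u v uv|u|u v _|u v w _ + _].
- exact/rst_sym/rst_step.
- exact: rst_refl.
- exact: rst_sym.
- exact: rst_trans.
Qed.

Lemma Aut_converse (Gamma : digraph) (g : Gamma -> Gamma) :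
  @Aut (converse Gamma) g <-> @Aut Gamma g.
Proof. by split=> -[g_bij gE]; split=> // u v; apply: gE. Qed.

Lemma arc_transitive_converse (Gamma : digraph) :
  arc_transitive Gamma -> arc_transitive (converse Gamma).
Proof.
move=> arc_trans u v u' v' uv u'v'.
have [g /Aut_converse g_aut [gv gu]] := arc_trans _ _ _ _ uv u'v'.
by exists g.
Qed.

(** A k-arc read backwards through [rev_ord] is a k-arc of the converse, and the automorphisms are
    the same. *)
Lemma highly_arc_transitive_converse (Gamma : digraph) :
  highly_arc_transitive (converse Gamma) -> highly_arc_transitive Gamma.
Proof.
move=> hat k s t s_arc t_arc.
have rev_arc (x : 'I_k.+1 -> Gamma) :
    is_karc x -> @is_karc (converse Gamma) k (x \o @rev_ord k.+1).
  by move=> x_arc i j ij; apply: x_arc => /=; have := ltn_ord j; lia.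
have [g /Aut_converse g_aut gst] :=
  hat k _ _ (rev_arc s s_arc) (rev_arc t t_arc).
by exists g => // i; have := gst (rev_ord i); rewrite /= rev_ordK.
Qed.

Theorem corollary5 (Gamma : digraph) (phi : Gamma -> vecZ) (p q : nat)
  (Gamma_connected : connected Gamma)
  (Gamma_arc_transitive : arc_transitive Gamma)
  (Gamma_property_Z : property_Z Gamma)
  (phi_surjective_hom : surjective_hom phi)
  (q_prime : prime q) (p_prime : prime p)
  (Gamma_in_valency : in_valency Gamma q)
  (Gamma_out_valency : out_valency Gamma p)
  (stabilizer_nontrivial :
     pointwise_stabilizer (phi @^-1` [set (0%R : int)]) <> [set idfun]) :
  highly_arc_transitive Gamma.
Proof.
have [phi_hom phi_surj] := phi_surjective_hom.
have [a phi_a] := phi_surj (0%R : int).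
have [g [[g_aut g_fix] [x gx]]] :
    exists g, pointwise_stabilizer (phi @^-1` [set (0%R : int)]) g /\
      exists x, g x <> x.
  apply: contrapT => no_g; apply: stabilizer_nontrivial.
  apply/seteqP; split=> [g g_stab|_ ->]; last by split=> //; apply: Aut_id.
  apply/funext => x; apply: contrapT => gx; apply: no_g.
  by exists g; split=> //; exists x.
have out_ex v :=
  card_eq_II_inhabited (prime_gt0 p_prime) (Gamma_out_valency v).
have in_ex v := card_eq_II_inhabited (prime_gt0 q_prime) (Gamma_in_valency v).
pose phiZ : Gamma -> int := phi.
have [x_gt0|x_lt0|x0] := Num.Theory.ltrgt0P (phiZ x).
- by apply: (@highly_arc_transitive_of_moved_above Gamma phiZ _ _ p g a x).
- apply: highly_arc_transitive_converse.
  (* Negated levels rise by 1 along reversed arcs and keep level 0; [x] becomes positive, and the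
     in-valency [q] becomes the out-valency. *)
  apply: (@highly_arc_transitive_of_moved_above (converse Gamma)
    (fun y => - phiZ y)%R _ _ q g a x) => //.
  + exact: connected_converse.
  + by move=> u v /phi_hom /=; rewrite /phiZ => ->; lia.
  + exact: arc_transitive_converse.
  + exact/Aut_converse.
  + by rewrite /phiZ phi_a.
  + by move=> y phi_y; apply: g_fix; move: phi_y; rewrite /phiZ /=; lia.
  + by lia.
- by case: gx; apply: g_fix.
Qed.
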